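(* $\mathrm{LNSA}^{\mathrm{metric}}$ is not invariant under invertible linear transformations: there exist point clouds $X=\{x_1,\ldots,x_N\}\subset\mathbb{R}^n$ and $Y=\{y_1,\ldots,y_N\}\subset\mathbb{R}^m$ of the same size, a neighbour count $k$ with $1\le k\le N-1$, and an invertible linear map $A:\mathbb{R}^n\to\mathbb{R}^n$ such that, with $X_A=\{Ax_1,\ldots,Ax_N\}$, one has $\mathrm{LNSA}^{\mathrm{metric}}(X_A,Y)\ne\mathrm{LNSA}^{\mathrm{metric}}(X,Y)$.
   Context: A point cloud of size $N$ in $\mathbb{R}^n$ is a family of points $x_1,\ldots,x_N\in\mathbb{R}^n$ indexed by $1,\ldots,N$; the points of each cloud are assumed pairwise distinct. $d(\cdot,\cdot)$ is Euclidean distance. Let $k$ be an integer with $1\le k\le N-1$. For an index $i$, $kNN_X(i)=(i_1,\ldots,i_k)$ denotes the indices of the $k$ nearest neighbours of $x_i$ in $X$ (other than $i$ itself), listed in order of increasing distance from $x_i$, ties being broken by smaller index. For a $k$-tuple of indices different from $i$, define the approximate dimensionality $$\mathrm{AD}_X(i,(i_1,\ldots,i_k))=-\left(\frac1k\sum_{j=1}^k\log\frac{d(x_i,x_{i_j})}{d(x_i,x_{i_k})}\right)^{-1},$$ so that its reciprocal is $\mathrm{AD}_X(i,(i_1,\ldots,i_k))^{-1}=-\frac1k\sum_{j=1}^k\log\frac{d(x_i,x_{i_j})}{d(x_i,x_{i_k})}$ (only this reciprocal is used below, and it is taken to be defined by this formula even when it is $0$). Set $\mathrm{lid}(i,X)=\mathrm{AD}_X(i,kNN_X(i))$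 and, for point clouds $X,Y$ of the same size $N$ (possibly in different dimensions), $\overline{\mathrm{lid}}_X(i,Y)=\mathrm{AD}_Y(i,kNN_X(i))$. Define $$\mathrm{LNSA}_Y(X)=\frac1N\sum_{i=1}^N\left(\mathrm{lid}(i,Y)^{-1}-\overline{\mathrm{lid}}_Y(i,X)^{-1}\right)^2,\qquad \mathrm{LNSA}^{\mathrm{metric}}(X,Y)=\mathrm{LNSA}_X(Y)+\mathrm{LNSA}_Y(X).$$ *)

(* Defs.v *)
From mathcomp Require Import all_boot all_order all_algebra.
From mathcomp Require Import reals exp.

Set Implicit Arguments.
Unset Strict Implicit.
Unset Printing Implicit Defensive.

Import Order.TTheory GRing.Theory Num.Theory.

Local Open Scope ring_scope.

(* A family of N points of R^n.  Pairwise distinctness is not part of the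
   type; it is stated separately as [injective X]. *)
Definition cloud (R : realType) (N n : nat) : Type := 'I_N -> 'cV[R]_n.

(* The library norm on matrices is the sup norm, hence this definition. *)
Definition edist (R : realType) (n : nat) (x y : 'cV[R]_n) : R :=
  Num.sqrt (\sum_(l < n) (x l 0 - y l 0) ^+ 2).

Section LNSA.
Variables (R : realType) (N : nat).

(* [j1] comes before [j2] in the list of neighbours of [i]. *)
Definition nearer (n : nat) (X : cloud R N n) (i : 'I_N) : rel 'I_N :=
  fun j1 j2 =>
    (edist (X i) (X j1) < edist (X i) (X j2))
    || (edist (X i) (X j1) == edist (X i) (X j2)) && (j1 <= j2)%N.

Definition kNN (k n : nat) (X : cloud R N n) (i : 'I_N) : seq 'I_N :=
  take k (sort (nearer X i) [seq j <- enum 'I_N | j != i]).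

Lemma size_kNN (k n : nat) (X : cloud R N n) (i : 'I_N) :
  (k <= N - 1)%N -> size (kNN k X i) = k.
Proof.
move=> lekN; rewrite size_takel// size_sort size_filter.
have := count_predC (pred1 i) (enum 'I_N).
rewrite size_enum_ord count_uniq_mem ?enum_uniq// mem_enum/= => eN.
by rewrite -eN addKn in lekN.
Qed.

(* Here k is [size s], and i_k is [last i s]. *)
Definition AD (n : nat) (X : cloud R N n) (i : 'I_N) (s : seq 'I_N) : R :=
  - ((size s)%:R^-1 *
     \sum_(j <- s) ln (edist (X i) (X j) / edist (X i) (X (last i s))))^-1.

(* Since 0^-1 = 0, the reciprocal is given by the expected formula even when
   the sum of logarithms vanishes. *)
Lemma AD_inv (n : nat) (X : cloud R N n) (i : 'I_N) (s : seq 'I_N) :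
  (AD X i s)^-1 =
  - ((size s)%:R^-1 *
     \sum_(j <- s) ln (edist (X i) (X j) / edist (X i) (X (last i s)))).
Proof. by rewrite /AD invrN invrK. Qed.

Definition lid (k n : nat) (i : 'I_N) (X : cloud R N n) : R :=
  AD X i (kNN k X i).

(* [lidbar k X i Y]: neighbours taken in X, distances taken in Y. *)
Definition lidbar (k n m : nat) (X : cloud R N n) (i : 'I_N)
    (Y : cloud R N m) : R :=
  AD Y i (kNN k X i).

(* [LNSA k Y X] is LNSA_Y(X): the subscript comes first. *)
Definition LNSA (k n m : nat) (Y : cloud R N m) (X : cloud R N n) : R :=
  N%:R^-1 *
  \sum_(i < N) ((lid k i Y)^-1 - (lidbar k Y i X)^-1) ^+ 2.

Definition LNSA_metric (k n m : nat) (X : cloud R N n) (Y : cloud R N m) : R :=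
  LNSA k X Y + LNSA k Y X.

End LNSA.

(* Main.v *)
(** Take Y = X.  Then LNSA^metric(X, X) = 0, so it suffices to find an
invertible A with LNSA_X(X_A) > 0.  With N = 3 and k = 2, let X consist of the
origin, (1, 0) and (0, 2), and let A = diag(4, 1).  The neighbours of the origin
in X are (1, 0) and then (0, 2), at distances 1 and 2, but A moves them to
distances 4 and 2: the reciprocals of the two approximate dimensionalities at
the origin are ln 2 / 2 and - ln 2 / 2. *)
Require Import Defs.
From mathcomp Require Import all_boot all_order all_algebra.
From mathcomp Require Import reals exp.
From mathcomp Require Import lra.

Import Order.TTheory GRing.Theory Num.Theory.
Local Open Scope ring_scope.

Lemma LNSA_ge0 (R : realType) (N k n m : nat) (Y : cloud R N m)
  (X : cloud R N n) : 0 <= LNSA k Y X.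
Proof.
by rewrite mulr_ge0 ?invr_ge0 ?ler0n// sumr_ge0// => i _; apply: sqr_ge0.
Qed.

(** All summands are squares, so a single nonzero one suffices; the index [i] itself witnesses that
    [N] is positive. *)
Lemma LNSA_gt0 (R : realType) (N k n m : nat) (Y : cloud R N m)
  (X : cloud R N n) (i : 'I_N) :
  (lid k i Y)^-1 != (lidbar k Y i X)^-1 -> 0 < LNSA k Y X.
Proof.
move=> neq; rewrite mulr_gt0 ?invr_gt0 ?ltr0n ?(leq_ltn_trans _ (ltn_ord i))//.
rewrite (bigD1 i)//= ltr_pwDl//; first by rewrite exprn_even_gt0//= subr_eq0.
by rewrite sumr_ge0// => j _; apply: sqr_ge0.
Qed.

(** On equal clouds [lidbar] unfolds to [lid], so every summand vanishes. *)
Lemma LNSA_metric_self (R : realType) (N k n : nat) (X : cloud R N n) :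
  LNSA_metric k X X = 0.
Proof.
have -> : LNSA_metric k X X = LNSA k X X + LNSA k X X by [].
suff -> : LNSA k X X = 0 by rewrite addr0.
by rewrite /LNSA big1 ?mulr0// => i _; rewrite subrr expr0n.
Qed.

(** The origin, (a, 0) and (0, b), in this order. Diagonal maps preserve this family, so it
    describes both X and its image. *)
Definition axis_cloud (R : realType) (a b : R) : cloud R 3 2 := fun i =>
  \col_l (if (i == 1) && (l == 0) then a
          else if (i == 2) && (l == 1) then b else 0).

Lemma axis_cloud_inj (R : realType) (a b : R) :
  a != 0 -> b != 0 -> injective (axis_cloud R a b).
Proof.
move=> a0 b0 i j /matrixP e; have := e 0 0; have := e 1 0; rewrite !mxE.
by case: i {e} => [[|[|[|//]]] ?]; case: j => [[|[|[|//]]] ?] /= => h1 h2;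
  apply: val_inj => //=; move: a0 b0; rewrite ?h1 -?h1 ?h2 -?h2 ?eqxx.
Qed.

Lemma edist_axis1 (R : realType) (a b : R) : 0 <= a ->
  edist (axis_cloud R a b 0) (axis_cloud R a b 1) = a.
Proof.
move=> a0; rewrite /edist big_ord_recl big_ord1 !mxE/= subr0 sub0r sqrrN.
by rewrite expr0n addr0 sqrtr_sqr ger0_norm.
Qed.

Lemma edist_axis2 (R : realType) (a b : R) : 0 <= b ->
  edist (axis_cloud R a b 0) (axis_cloud R a b 2) = b.
Proof.
move=> b0; rewrite /edist big_ord_recl big_ord1 !mxE/= subr0 sub0r sqrrN.
by rewrite expr0n add0r sqrtr_sqr ger0_norm.
Qed.

Lemma kNN_axis_cloud (R : realType) (a b : R) : 0 <= a -> a < b ->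
  kNN 2 (axis_cloud R a b) 0 = [:: 1; 2].
Proof.
move=> a0 ab; have b0 := le_trans a0 (ltW ab).
have e : [seq j <- enum 'I_3 | j != 0] = [:: 1; 2].
  by apply: (inj_map val_inj); rewrite !enum_ordSl enum_ord0.
by rewrite /kNN e /= /sort /= /nearer edist_axis1// edist_axis2// ab.
Qed.

(** The last neighbour contributes ln 1 = 0. No order between [a] and [b] is assumed, since the
    image cloud has a = 4 and b = 2. *)
Lemma AD_axis_cloud (R : realType) (a b : R) : 0 <= a -> 0 < b ->
  (AD (axis_cloud R a b) 0 [:: 1; 2])^-1 = - (2^-1 * ln (a / b)).
Proof.
move=> a0 b0; rewrite AD_inv big_cons big_seq1/= edist_axis1//.
by rewrite edist_axis2 ?ltW// divff ?gt_eqF// ln1 addr0.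
Qed.

Definition scale_axes (R : realType) (c d : R) : 'M[R]_2 :=
  diag_mx (\row_l (if l == 0 then c else d)).

Lemma scale_axesE (R : realType) (c d a b : R) (i : 'I_3) :
  scale_axes R c d *m axis_cloud R a b i = axis_cloud R (c * a) (d * b) i.
Proof.
apply/matrixP => l j; rewrite mul_diag_mx !mxE.
by case: l => [[|[|//]] ?] /=; rewrite ?andbF ?andbT; case: ifP => //; rewrite mulr0.
Qed.

Lemma scale_axes_unit (R : realType) (c d : R) :
  c != 0 -> d != 0 -> scale_axes R c d \in unitmx.
Proof.
move=> c0 d0; rewrite unitmxE det_diag big_ord_recl big_ord1 !mxE/=.
by rewrite unitfE mulf_neq0.
Qed.

Theorem mainTheorem15 (R : realType) :
  exists (N n m k : nat) (X : cloud R N n) (Y : cloud R N m)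
         (A : {linear 'cV[R]_n -> 'cV[R]_n}),
    [/\ injective X, injective Y, (1 <= k <= N - 1)%N, bijective A &
        LNSA_metric k (fun i => A (X i)) Y <> LNSA_metric k X Y].
Proof.
pose X := axis_cloud R 1 2; pose M := scale_axes R 4 1.
have Xinj : injective X by apply: axis_cloud_inj; rewrite ?pnatr_eq0 ?oner_eq0.
exists 3%N, 2%N, 2%N, 2%N, X, X, (mulmx M); split=> //.
  have uM : M \in unitmx by apply: scale_axes_unit; rewrite ?pnatr_eq0 ?oner_eq0.
  by exists (mulmx (invmx M)); [exact: mulKmx | exact: mulKVmx].
(* The summand left to bound below is LNSA_X(X_A), which takes its neighbours in X; index 0 is the
   origin. *)
rewrite LNSA_metric_self; apply/eqP; rewrite gt_eqF// ltr_wpDl ?LNSA_ge0//.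
apply: (@LNSA_gt0 _ _ _ _ _ _ _ 0).
(* The two clouds are known to agree only pointwise, so the equality is carried through the formula
   for [AD]. *)
have eAD s : AD (fun i => M *m X i) 0 s = AD (axis_cloud R 4 2) 0 s.
  rewrite /AD scale_axesE mulr1 mul1r; congr (- (_ * _)^-1).
  by apply: eq_bigr => j _; rewrite !scale_axesE mulr1 mul1r.
rewrite /lid /lidbar /= eAD kNN_axis_cloud ?ler01 ?ltr1n//.
rewrite !AD_axis_cloud ?ler01 ?ler0n ?ltr0n//.
have -> : 4 / 2 = 2 :> R by lra.
rewrite div1r lnV ?posrE ?ltr0n//.
have ln2 : 0 < ln (2 : R) by rewrite ln_gt0// ltr1n.
by apply/eqP; lra.
Qed.
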